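(* Let $\{f_i\}_{i\in I}$ be a frame for a separable Hilbert space $\mathcal H$ and let $\{g_i\}_{i\in I}$ be an alternate dual frame of $\{f_i\}_{i\in I}$. Then for any $\lambda\in\mathbb R$, all $J\subset I$ and any $f\in\mathcal H$, $$\mathrm{Re}\left(\sum_{i\in J}\langle f,g_i\rangle\overline{\langle f,f_i\rangle}\right)+\left\|\sum_{i\in J^c}\langle f,g_i\rangle f_i\right\|^2\ge(2\lambda-\lambda^2)\,\mathrm{Re}\left(\sum_{i\in J}\langle f,g_i\rangle\overline{\langle f,f_i\rangle}\right)+(1-\lambda^2)\,\mathrm{Re}\left(\sum_{i\in J^c}\langle f,g_i\rangle\overline{\langle f,f_i\rangle}\right).$$
   Context: Hilbert spaces are complex and $I$ is a countable index set. A sequence $\{f_i\}_{i\in I}$ in $\mathcal H$ is a frame for $\mathcal H$ if there are constants $A,B>0$ with $A\|f\|^2\le\sum_{i\in I}|\langle f,f_i\rangle|^2\le B\|f\|^2$ for all $f\in\mathcal H$. A frame $\{g_i\}_{i\in I}$ for $\mathcal H$ is an alternate dual frame of $\{f_i\}_{i\in I}$ if $f=\sum_{i\in I}\langle f,f_i\rangle g_i=\sum_{i\in I}\langle f,g_i\rangle f_i$ for all $f\in\mathcal H$. For $J\subset I$, $J^c=I\setminus J$. *)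

(* Defs.v *)
From HB Require Import structures.
From mathcomp Require Import all_boot all_order all_algebra.
From mathcomp Require Import sesquilinear complex.
From mathcomp Require Import all_classical all_reals all_analysis.
From mathcomp Require Import showcase.summability.

Set Implicit Arguments.
Unset Strict Implicit.
Unset Printing Implicit Defensive.

Import Order.TTheory GRing.Theory Num.Theory.
Import numFieldNormedType.Exports.

Local Open Scope classical_set_scope.
Local Open Scope ring_scope.

Definition separable (T : topologicalType) : Prop :=
  exists2 D : set T, countable D & dense D.

(* Norms over R[i] take their (nonnegative real) values in R[i]; this is the
   same number as an element of R. It also gives the modulus on R[i]. *)
Definition rnorm (R : realType) (V : normedZmodType R[i]) (x : V) : R :=
  complex.Re `|x|.

(* A complex Hilbert space is a complete normed space over R[i] whose norm
   comes from ip; ip is linear in its first argument and conjugate-linear in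
   its second. *)
Definition norm_induced_by (R : realType) (H : normedModType R[i])
    (ip : {dot H for Num.conj}) : Prop :=
  forall x : H, `|x| ^+ 2 = ip x x.

(* Unconditional summation: the limit is along the net of finite subsets of I. *)
Definition sums_to (R : realType) (I : choiceType) (V : normedModType R[i])
    (x : I -> V) (v : V) : Prop :=
  partial_sum x @ totally --> v.

(* \sum_(i in J) x i, unconditionally; an unspecified value if it diverges. *)
Definition sum_over (R : realType) (I : choiceType) (V : normedModType R[i])
    (J : set I) (x : I -> V) : V :=
  summability.sum (patch (fun=> 0) J x).

Definition is_frame (R : realType) (H : normedModType R[i])
    (ip : {dot H for Num.conj}) (I : countType) (f : I -> H) : Prop :=
  exists A B : R, [/\ 0 < A, 0 < B & forall h : H,
    ((A * rnorm h ^+ 2)%:E <= \esum_(i in [set: I]) (rnorm (ip h (f i)) ^+ 2)%:E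
       <= (B * rnorm h ^+ 2)%:E)%E].

Definition is_alternate_dual (R : realType) (H : normedModType R[i])
    (ip : {dot H for Num.conj}) (I : countType) (f g : I -> H) : Prop :=
  is_frame ip g /\
  forall h : H, sums_to (fun i => ip h (f i) *: g i) h /\
                sums_to (fun i => ip h (g i) *: f i) h.

(* Main.v *)
Require Import Defs.
From HB Require Import structures.
From mathcomp Require Import all_boot all_order all_algebra.
From mathcomp Require Import sesquilinear complex.
From mathcomp Require Import all_classical all_reals all_analysis.
From mathcomp Require Import finmap showcase.summability ring lra.

(** Write [x i := <h, g_i> f_i], and let [Q], [P] be the sums of [x] over [J]
and over its complement. Duality says that the whole family [x] sums to [h],
so [Q + P = h]. As [<h, g_i> * conj <h, f_i> = <x i, h>], the scalar sum over
a set of indices is the inner product with [h] of the vector sum over the same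
set. Substituting [Q = h - P], the difference of the two sides of the
inequality is
<<
  (1 - lambda)^2 |h|^2 - 2 (1 - lambda) Re <P, h> + |P|^2
>>
which is [|P - (1 - lambda) h|^2], hence nonnegative.

The analysis lies in making sense of the partial sums [Q] and [P]. A subfamily
of an unconditionally summable family in a complete space is summable
([summable_patch]): beyond a large finite set [A], a finite sum of the
subfamily is also a finite sum of the whole family over indices outside [A],
so it is small by the Cauchy criterion. Thus [sum_overDC] gives [Q + P = h].
Exchanging the inner product with the sums ([sum_over_linear]) requires the
continuity of [<_, h>], which is the Cauchy-Schwarz inequality. *)

Set Implicit Arguments.
Unset Strict Implicit.

Import Order.TTheory GRing.Theory Num.Theory.
Import numFieldNormedType.Exports.
Local Open Scope classical_set_scope.
Local Open Scope ring_scope.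

(** * Unconditional sums over subsets of the index set *)

#[local] Existing Instance totally_filter.

Lemma partial_sumE (I : choiceType) (V : zmodType) (x : I -> V) (A : {fset I}) :
  partial_sum x A = \sum_(i <- A) x i.
Proof. by rewrite /partial_sum big_seq_fsetE. Qed.

(** The Cauchy estimate behind subfamilies: an increment of the partial sums of
the restriction to [J], from [A] to [B], is an increment of the partial sums
of the full family, from [A] to [A] enlarged by the part of [J] in [B]. *)
Lemma partial_sum_patchB (I : choiceType) (V : zmodType) (x : I -> V)
    (J : set I) (A B : {fset I}) : (A `<=` B)%fset ->
  partial_sum (patch (fun=> 0) J x) A - partial_sum (patch (fun=> 0) J x) B =
  partial_sum x A - partial_sum x [fset i in B | (i \in A) || (i \in J)]%fset.
Proof.
move=> /fsubsetP AB.
have sumA (y : I -> V) :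
    partial_sum y A = \sum_(i <- B) (if i \in A then y i else 0).
  rewrite -big_mkcond partial_sumE [RHS]big_fset_condE.
  apply: eq_fbigl => i; rewrite !inE /=.
  by case: (boolP (i \in A)) => [/AB ->|]; rewrite ?andbF.
rewrite !sumA !partial_sumE big_fset /= [X in _ = _ - X]big_mkcond -!sumrB.
apply: eq_bigr => i _; rewrite /patch.
by case: (i \in A); case: (i \in J); rewrite /= ?subrr ?sub0r ?oppr0.
Qed.

(** Completeness is essential: the limit over the subfamily is not given in
advance, it only exists because the partial sums are Cauchy. *)
Lemma summable_patch (K : numFieldType) (V : completeNormedModType K)
    (I : choiceType) (x : I -> V) (J : set I) :
  cvg (partial_sum x @ totally) ->
  cvg (partial_sum (patch (fun=> 0) J x) @ totally).
Proof.
move=> /cvg_ex [v xv]; apply/cauchy_cvgP/cauchy_exP => e e0.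
have e20 : 0 < e / 2 by rewrite divr_gt0.
have [A _ nearA] : totally (fun B => ball v (e / 2) (partial_sum x B)).
  exact: (xv _ (nbhsx_ballx v (e / 2) e20)).
(* The partial sum over A is the centre of a ball of radius e that contains
   all later partial sums of the subfamily. *)
exists (partial_sum (patch (fun=> 0) J x) A), A => // B /= AB.
rewrite -ball_normE /= partial_sum_patchB//.
set C := [fset i in B | _]%fset.
suff : ball (partial_sum x A) e (partial_sum x C) by rewrite -ball_normE.
apply: (@ball_splitr _ _ v).
  exact/nearA/fsubset_refl.
apply: nearA; apply/fsubsetP => i iA.
by rewrite !inE/= iA (fsubsetP AB).
Qed.

Section sum_over.
Variables (R : realType) (I : choiceType).
Implicit Types (J : set I).

Lemma sum_over_eq (V : normedModType R[i]) J (x : I -> V) (v : V) :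
  sums_to (patch (fun=> 0) J x) v -> sum_over J x = v.
Proof. exact: (cvg_lim (@norm_hausdorff _ V)). Qed.

Lemma sums_to_sum_over (V : completeNormedModType R[i]) J (x : I -> V) (v : V) :
  sums_to x v -> sums_to (patch (fun=> 0) J x) (sum_over J x).
Proof. by move=> xv; apply: summable_patch; apply/cvg_ex; exists v. Qed.

Lemma sum_overDC (V : completeNormedModType R[i]) J (x : I -> V) (v : V) :
  sums_to x v -> sum_over J x + sum_over (~` J) x = v.
Proof.
move=> xv; apply: (cvg_unique (@norm_hausdorff _ V)) (xv).
have -> : partial_sum x = partial_sum (patch (fun=> 0) J x) \+
                          partial_sum (patch (fun=> 0) (~` J) x).
  apply/funext => A; rewrite /= /partial_sum -big_split /=.
  apply: eq_bigr => i _; rewrite /patch in_setC.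
  by case: (_ \in J); rewrite /= ?addr0 ?add0r.
by apply: cvgD; apply: sums_to_sum_over xv.
Qed.

Lemma sums_to_linear (V W : normedModType R[i]) (phi : {linear V -> W})
    (x : I -> V) (v : V) :
  continuous phi -> sums_to x v -> sums_to (phi \o x) (phi v).
Proof.
move=> phic xv; rewrite /sums_to.
have -> : partial_sum (phi \o x) = phi \o partial_sum x.
  by apply/funext => A; rewrite /partial_sum /= linear_sum.
exact: continuous_cvg (phic v) xv.
Qed.

Lemma sum_over_linear (V : completeNormedModType R[i]) (W : normedModType R[i])
    (phi : {linear V -> W}) J (x : I -> V) (v : V) :
  continuous phi -> sums_to x v ->
  sum_over J (phi \o x) = phi (sum_over J x).
Proof.
move=> phic /(@sums_to_sum_over _ J) /(sums_to_linear phic) xJ.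
apply: sum_over_eq; congr (sums_to _ _): xJ.
by apply/funext => i; rewrite /= /patch; case: ifP; rewrite ?linear0.
Qed.

End sum_over.

(** * Inner products *)

(** Valid in any dimension: the squared norm of [<v, v> u - <u, v> v], a
multiple of the component of [u] orthogonal to [v], is nonnegative and equals
[<v, v>] times the difference of the two sides. *)
Lemma dot_CauchySchwarz (C : numClosedFieldType) (U : lmodType C)
    (ip : {dot U for Num.conj}) (u v : U) :
  `|ip u v| ^+ 2 <= ip u u * ip v v.
Proof.
have [->|v0] := eqVneq v 0; first
  by rewrite linear0r normr0 expr0n mulr_ge0 ?dnorm_ge0.
have vv0 : 0 < ip v v by rewrite dnorm_gt0.
have cross : ip (ip v v *: u) (ip u v *: v) = ip v v * `|ip u v| ^+ 2.
  by rewrite linearZr_LR /= linearZl_LR /= normCK; ring.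
have := dnorm_ge0 ip (ip v v *: u - ip u v *: v).
rewrite dnormB !dnormZ cross /= (ger0_norm (ltW vv0)).
(* The cross term is real, so it equals its conjugate. *)
rewrite (CrealP _) ?realM ?realX ?normr_real ?gtr0_real//.
set N := `|_| ^+ 2.
have -> : ip v v ^+ 2 * ip u u + N * ip v v - (ip v v * N + ip v v * N) =
    ip v v * (ip u u * ip v v - N) by ring.
by rewrite pmulr_rge0// subr_ge0.
Qed.

Section hilbert.
Variables (R : realType) (H : normedModType R[i]) (ip : {dot H for Num.conj}).
Hypothesis H_hilbert : norm_induced_by ip.

Lemma conj_ip (u v : H) : (ip u v)^* = ip v u.
Proof. by rewrite (hermC ip v u) mul1r. Qed.

Lemma norm_ip_le (u v : H) : `|ip u v| <= `|u| * `|v|.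
Proof.
rewrite -(@ler_pXn2r _ 2)// ?nnegrE ?mulr_ge0// exprMn !H_hilbert.
exact: dot_CauchySchwarz.
Qed.

(** The codomain is [R[i]] seen as a normed space over itself, which is where
the scalar families are summed. *)
Definition ipl (k u : H) : R[i]^o := ip u k.

Lemma ipl_linear k : linear (ipl k).
Proof. by move=> a u v; rewrite /ipl linearDl/= linearZl_LR. Qed.

HB.instance Definition _ k := GRing.isLinear.Build _ _ _ _ (ipl k) (ipl_linear k).

Lemma continuous_ipl (k : H) : continuous (ipl k).
Proof.
apply/linear_bounded_continuous/linear_boundedP; near=> M => u.
by rewrite mulrC; apply: le_trans (norm_ip_le u k) _; rewrite ler_wpM2l//;
  near: M; apply: nbhs_pinfty_ge; rewrite normr_real.
Unshelve. all: by end_near. Qed.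

(** The real inner product underlying [ip]: bilinear and symmetric over [R], so
that the final computation is one of real quadratic forms. *)
Definition reip (u v : H) : R := complex.Re (ip u v).

Lemma reipC u v : reip u v = reip v u.
Proof. by rewrite /reip -(conj_ip v u); case: (ip v u). Qed.

Lemma reipDl u v w : reip (u + v) w = reip u w + reip v w.
Proof. by rewrite /reip linearDl raddfD. Qed.

Lemma reipZl (a : R) u w : reip (a%:C%C *: u) w = a * reip u w.
Proof.
rewrite /reip linearZl_LR /=.
by case: (ip u w) => x y /=; rewrite mul0r subr0.
Qed.

Lemma reip_ge0 u : 0 <= reip u u.
Proof. by have := dnorm_ge0 ip u; rewrite lecE => /andP[]. Qed.

Lemma rnorm_sqr u : rnorm u ^+ 2 = reip u u.
Proof.
rewrite /reip -H_hilbert /rnorm -{2}(RRe_real (normr_real u)).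
by rewrite -rmorphXn.
Qed.

End hilbert.

(** * The inequality *)

Unset Implicit Arguments.
Set Strict Implicit.

Theorem theorem2p11 (R : realType) (H : completeNormedModType R[i])
    (ip : {dot H for Num.conj}) (H_hilbert : norm_induced_by ip)
    (H_separable : separable H)
    (I : countType) (f g : I -> H)
    (f_frame : is_frame ip f) (g_dual : is_alternate_dual ip f g)
    (lambda : R) (J : set I) (h : H) :
  complex.Re (sum_over J (fun i => ip h (g i) * (ip h (f i))^* : R[i]^o))
    + rnorm (sum_over (~` J) (fun i => ip h (g i) *: f i)) ^+ 2
  >= (2 * lambda - lambda ^+ 2)
       * complex.Re (sum_over J (fun i => ip h (g i) * (ip h (f i))^* : R[i]^o))
     + (1 - lambda ^+ 2)
       * complex.Re (sum_over (~` J) (fun i => ip h (g i) * (ip h (f i))^* : R[i]^o)).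
Proof.
have [_ /(_ h) [_ sumx]] := g_dual.
set x := fun i => ip h (g i) *: f i in sumx *.
have scal K :
    complex.Re (sum_over K (fun i => ip h (g i) * (ip h (f i))^* : R[i]^o)) =
    reip ip (sum_over K x) h.
  rewrite /reip -[ip (sum_over K x) h]/(ipl ip h _).
  rewrite -(sum_over_linear K (continuous_ipl H_hilbert (k:=h)) sumx).
  congr (complex.Re (@sum_over R I R[i]^o K _)); apply/funext => i /=.
  by rewrite /ipl /x linearZl_LR /= conj_ip.
rewrite !scal (rnorm_sqr H_hilbert).
have hQP := sum_overDC J sumx.
set Q := sum_over J x in hQP *; set P := sum_over (~` J) x in hQP *.
have QE : reip ip Q h = reip ip h h - reip ip P h.
  by rewrite -[X in reip ip X h - _]hQP reipDl addrK.
(* The two sides of the inequality differ by the squared norm of this vector. *)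
have := reip_ge0 ip (P + (lambda - 1)%:C%C *: h).
rewrite reipDl reipZl ![reip ip _ (P + _)]reipC !reipDl !reipZl (reipC ip h P) QE.
nra.
Qed.
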